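(* Let $A,B\in\mathcal M_n$ be accretive with $W(A),W(B)\subset S_\alpha$ for some $0\le\alpha<\pi/2$. Let $f\in\mathfrak m$ with $f'(1)=t\in(0,1)$. Then $$\cos^2(\alpha)\,\Re(A!_tB)\le\Re(A\sigma_fB)\le\sec^2(\alpha)\,\Re(A\nabla_tB).$$
   Context: A matrix $A$ is accretive if $\Re A=\frac{A+A^*}{2}$ is positive definite. $W(A)$ is the numerical range, $S_\alpha=\{z:\Re z>0,\ |\Im z|\le\tan(\alpha)\Re z\}$. $\le$ is the Löwner order. $\mathfrak m$ is the set of matrix monotone $f:(0,\infty)\to(0,\infty)$ with $f(1)=1$; each has a unique probability measure $\nu_f$ on $[0,1]$ with $f(x)=\int_0^1((1-t)+tx^{-1})^{-1}d\nu_f(t)$, $x>0$. For accretive $A,B$: $A\nabla_tB=(1-t)A+tB$, $A!_tB=((1-t)A^{-1}+tB^{-1})^{-1}$, and $A\sigma_fB:=\int_0^1A!_sB\,d\nu_f(s)$. *)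

(* Defs.v *)
From HB Require Import structures.
From mathcomp Require Import all_boot all_order all_algebra.
From mathcomp Require Import all_classical all_reals all_analysis.
From mathcomp Require Import complex.

Set Implicit Arguments.
Unset Strict Implicit.
Unset Printing Implicit Defensive.

Import Order.TTheory GRing.Theory Num.Theory.
Local Open Scope ring_scope.
Local Open Scope classical_set_scope.

Section MatrixMeans.
Variables (R : realType) (n : nat).
Local Notation C := R[i].

Definition cadj (m p : nat) (A : 'M[C]_(m, p)) : 'M[C]_(p, m) :=
  (map_mx (@conjc R) A)^T.

Definition qform (M : 'M[C]_n) (x : 'cV[C]_n) : C := (cadj x *m M *m x) 0 0.

Definition ReMx (A : 'M[C]_n) : 'M[C]_n := 2^-1 *: (A + cadj A).

(* positive semidefinite / Loewner order  X <= Y  iff  Y - X is psd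
   (order of the num-domain R[i]:  0 <= z  iff  z real and nonnegative) *)
Definition psd (M : 'M[C]_n) : Prop := forall x : 'cV[C]_n, 0 <= qform M x.
Definition loewner_le (X Y : 'M[C]_n) : Prop := psd (Y - X).

Definition posdef (M : 'M[C]_n) : Prop :=
  cadj M = M /\ forall x : 'cV[C]_n, x != 0 -> 0 < qform M x.

Definition accretive (A : 'M[C]_n) : Prop := posdef (ReMx A).

Definition numrange (A : 'M[C]_n) : set C :=
  [set z | exists x : 'cV[C]_n, qform 1%:M x = 1 /\ z = qform A x].

Definition sector (alpha : R) : set C :=
  [set z | 0 < complex.Re z /\ `|complex.Im z| <= tan alpha * complex.Re z].

Definition wamean (t : R) (A B : 'M[C]_n) : 'M[C]_n :=
  ((1 - t)%:C)%C *: A + (t%:C)%C *: B.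

Definition whmean (t : R) (A B : 'M[C]_n) : 'M[C]_n :=
  invmx (((1 - t)%:C)%C *: invmx A + (t%:C)%C *: invmx B).

(* A sigma_f B := int_0^1 A !_s B d nu_f(s), computed entrywise
   (real and imaginary parts integrated separately) *)
Definition sigmaf (nu : probability R R) (A B : 'M[C]_n) : 'M[C]_n :=
  \matrix_(i, j)
    ((\int[nu]_(s in `[0%R, 1%R]) complex.Re (whmean s A B i j))
      +i* (\int[nu]_(s in `[0%R, 1%R]) complex.Im (whmean s A B i j)))%C.

End MatrixMeans.

Definition fnu (R : realType) (nu : probability R R) (x : R) : R :=
  \int[nu]_(s in `[0%R, 1%R]) ((1 - s) + s / x)^-1.

(* Main.v *)
Require Import Defs.
From HB Require Import structures.
From mathcomp Require Import all_boot all_order all_algebra.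
From mathcomp Require Import all_classical all_reals all_analysis.
From mathcomp Require Import complex.
From mathcomp Require Import ring lra.
Set Implicit Arguments.
Unset Strict Implicit.
Unset Printing Implicit Defensive.

Import Order.TTheory GRing.Theory Num.Theory.
Import numFieldNormedType.Exports.
Local Open Scope ring_scope.
Local Open Scope classical_set_scope.

(* For M with numerical range in the sector, polarization gives
     2 Re <x, M u> <= Re <u, M u> + sec^2(alpha) Re <x, M x>.
   Upper bound: put y = (A !_s B) x, u = A^-1 y, v = B^-1 y, so that
   x = (1-s) u + s v, and apply this to (A, u) and (B, v).
   Lower bound: H_s = (1-s) A^-1 + s B^-1 is again sectorial; applied to H_s,
   u = H_s^-1 x and the fixed vector cos^2(alpha) H_t^-1 x, the inequality bounds
   Re <x, (A !_s B) x> from below by an affine function of s.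
   Both bounds integrate, because f'(1) = t is the mean of nu:
   f(z) - 1 = (z - 1) int s / (z (1-s) + s) dnu(s). *)

(* Locked, so that the unifier never compares two distinct forms by unfolding
   the matrix products. *)
HB.lock Definition sform (R : realType) (n : nat) (M : 'M[R[i]]_n)
  (x y : 'cV[R[i]]_n) : R[i] := (cadj x *m M *m y) 0 0.

(** * Complex arithmetic, sesquilinear forms and the Loewner order *)

Section SesquilinearForm.
Variable (R : realType).
Implicit Types (c : R[i]).

Lemma Re_mul c d :
  complex.Re (c * d) = complex.Re c * complex.Re d - complex.Im c * complex.Im d.
Proof. by case: c; case: d. Qed.

Lemma Im_mul c d :
  complex.Im (c * d) = complex.Re c * complex.Im d + complex.Im c * complex.Re d.
Proof. by case: c => a b; case: d => a' b' /=. Qed.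

Lemma Re_add c d : complex.Re (c + d) = complex.Re c + complex.Re d.
Proof. by case: c; case: d. Qed.

Lemma Im_add c d : complex.Im (c + d) = complex.Im c + complex.Im d.
Proof. by case: c; case: d. Qed.

Lemma Re_conjc c : complex.Re (conjc c) = complex.Re c.
Proof. by case: c. Qed.

Lemma Im_conjc c : complex.Im (conjc c) = - complex.Im c.
Proof. by case: c. Qed.

Lemma conjc_real (r : R) : conjc ((r%:C)%C) = (r%:C)%C.
Proof. by rewrite /conjc /= oppr0. Qed.

Lemma Re_realM (r : R) c : complex.Re ((r%:C)%C * c) = r * complex.Re c.
Proof. by rewrite Re_mul mul0r subr0. Qed.

Lemma Im_realM (r : R) c : complex.Im ((r%:C)%C * c) = r * complex.Im c.
Proof. by rewrite Im_mul mul0r addr0. Qed.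

Lemma cadjD m p (X Y : 'M[R[i]]_(m, p)) : cadj (X + Y) = cadj X + cadj Y.
Proof. by rewrite /cadj map_mxD linearD. Qed.

Lemma cadjZ m p c (X : 'M[R[i]]_(m, p)) : cadj (c *: X) = conjc c *: cadj X.
Proof. by rewrite /cadj map_mxZ linearZ. Qed.

Lemma cadjM m p q (X : 'M[R[i]]_(m, p)) (Y : 'M[R[i]]_(p, q)) :
  cadj (X *m Y) = cadj Y *m cadj X.
Proof. by rewrite /cadj map_mxM trmx_mul. Qed.

Lemma cadjK m p (X : 'M[R[i]]_(m, p)) : cadj (cadj X) = X.
Proof. by apply/matrixP => i j; rewrite !mxE conjcK. Qed.

Variable n : nat.
Implicit Types (M N : 'M[R[i]]_n) (x y z : 'cV[R[i]]_n).

Lemma qformE M x : qform M x = sform M x x. Proof. by rewrite unlock. Qed.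

Lemma sformDl M x y z : sform M (x + y) z = sform M x z + sform M y z.
Proof. by rewrite unlock cadjD !mulmxDl mxE. Qed.

Lemma sformDr M x y z : sform M x (y + z) = sform M x y + sform M x z.
Proof. by rewrite unlock mulmxDr mxE. Qed.

Lemma sformZl M c x y : sform M (c *: x) y = conjc c * sform M x y.
Proof. by rewrite unlock cadjZ -!scalemxAl mxE. Qed.

Lemma sformZr M c x y : sform M x (c *: y) = c * sform M x y.
Proof. by rewrite unlock -scalemxAr mxE. Qed.

Lemma sform_lincomb M c d x y :
  sform M (c *: x + d *: y) (c *: x + d *: y) =
  conjc c * (c * sform M x x + d * sform M x y) +
  conjc d * (c * sform M y x + d * sform M y y).
Proof.
rewrite (sformDl M (c *: x)) (sformZl M c x) (sformZl M d y).
rewrite (sformDr M x (c *: x)) (sformDr M y (c *: x)).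
by rewrite (sformZr M c x x) (sformZr M d x y) (sformZr M c y x) (sformZr M d y y).
Qed.

Lemma sform_addmx M N x y : sform (M + N) x y = sform M x y + sform N x y.
Proof. by rewrite unlock mulmxDr mulmxDl mxE. Qed.

Lemma sform_scalemx M c x y : sform (c *: M) x y = c * sform M x y.
Proof. by rewrite unlock -scalemxAr -scalemxAl mxE. Qed.

Lemma sform_cadj M x y : sform (cadj M) x y = conjc (sform M y x).
Proof.
rewrite unlock -[in LHS](cadjK y) -!cadjM mulmxA.
by rewrite /cadj !mxE.
Qed.

Lemma sform1_conj x y : sform 1%:M x y = conjc (sform 1%:M y x).
Proof.
by rewrite -sform_cadj /cadj map_scalar_mx rmorph1 tr_scalar_mx.
Qed.

(** Moves [M] into the second argument, so that an equation such as [M *m u = y] can be substituted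
    and forms of different matrices become comparable. *)
Lemma sformE M x y : sform M x y = sform 1%:M x (M *m y).
Proof. by rewrite unlock mulmx1 mulmxA. Qed.

Lemma qform_ReMx M x : qform (ReMx M) x = ((complex.Re (qform M x))%:C)%C.
Proof.
rewrite !qformE /ReMx sform_scalemx sform_addmx sform_cadj addcJ.
by rewrite mulrA mulVf ?mul1r // pnatr_eq0.
Qed.

(** The quadratic form of [ReMx M] is the real part of that of [M], so the order of [R[i]] reduces
    to the order of [R]. *)
Lemma loewner_leP M N :
  (forall x, complex.Re (qform M x) <= complex.Re (qform N x)) ->
  loewner_le (ReMx M) (ReMx N).
Proof.
move=> le x; rewrite -scaleN1r qformE sform_addmx [X in _ + X]sform_scalemx -!qformE.
by rewrite !qform_ReMx mulN1r -rmorphB /= ler0c subr_ge0.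
Qed.

Lemma ReMxZ (r : R) M : ReMx ((r%:C)%C *: M) = (r%:C)%C *: ReMx M.
Proof.
by rewrite /ReMx cadjZ conjc_real -scalerDr !scalerA mulrC.
Qed.

Lemma qform1_ge0 x : 0 <= complex.Re (qform 1%:M x) /\
  complex.Im (qform 1%:M x) = 0.
Proof.
rewrite /qform mulmx1 mxE raddf_sum/= raddf_sum/=; split.
  apply: sumr_ge0 => i _; rewrite !mxE Re_mul Re_conjc Im_conjc; nra.
by apply: big1 => i _; rewrite !mxE Im_mul Re_conjc Im_conjc; ring.
Qed.

Lemma qform1_eq0 x : complex.Re (qform 1%:M x) = 0 -> x = 0.
Proof.
rewrite /qform mulmx1 mxE raddf_sum/= => /eqP.
rewrite psumr_eq0; last first.
  by move=> i _; rewrite !mxE Re_mul Re_conjc Im_conjc; nra.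
move=> /allP s0; apply/matrixP => i j; rewrite (ord1 j) [RHS]mxE.
have /implyP/(_ isT)/eqP := s0 i (mem_index_enum _).
rewrite !mxE Re_mul Re_conjc Im_conjc; case: (x i 0) => a b /= h.
by congr (_ +i* _)%C; nra.
Qed.

Lemma sformr0 M x : sform M x 0 = 0.
Proof. by rewrite unlock mulmx0 mxE. Qed.

End SesquilinearForm.

(** * Sectorial matrices and pointwise bounds for the weighted harmonic mean *)

Section Sectorial.
Variables (R : realType) (n : nat).
Implicit Types (M N : 'M[R[i]]_n) (x y z : 'cV[R[i]]_n) (tau : R).

(** Homogeneous version of $W(M)\subset S_\alpha$ with [tau] in the role of $\tan\alpha$: no
    normalization of [x] is required. *)
Definition sectorial tau M := forall x, x != 0 ->
  0 < complex.Re (sform M x x) /\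
  `|complex.Im (sform M x x)| <= tau * complex.Re (sform M x x).

Lemma sectorial_numrange M alpha :
  numrange M `<=` sector alpha -> sectorial (tan alpha) M.
Proof.
move=> WM x x0; have [q0 qi] := qform1_ge0 x.
have qn0 : complex.Re (qform 1%:M x) != 0.
  by apply: contra_neq x0; exact: qform1_eq0.
set r := complex.Re _ in q0 qn0 *.
have rp : 0 < r by rewrite lt_def qn0.
have qr : qform 1%:M x = (r%:C)%C.
  by rewrite /r; case: (qform _ _) qi => a b /= ->.
pose s := Num.sqrt r.
have sp : 0 < s by rewrite sqrtr_gt0.
have ss : s * s = r by rewrite -expr2 sqr_sqrtr.
(* Normalizing [x] divides its form by the squared norm [r]; this positive factor cancels from both
   sector conditions. *)
pose y := ((s^-1)%:C)%C *: x.
have qy N : qform N y = ((r^-1)%:C)%C * qform N x.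
  rewrite !qformE sformZl sformZr conjc_real mulrA -rmorphM /=.
  by rewrite -invfM ss.
rewrite -qformE; have : numrange M (qform M y).
  by exists y; rewrite qy qr -rmorphM mulVf.
move=> /WM []; rewrite qy Re_mul Im_mul /= !mul0r subr0 addr0.
have ip : 0 < r^-1 by rewrite invr_gt0.
rewrite pmulr_rgt0 // => -> ; rewrite normrM (gtr0_norm ip) mulrCA.
by rewrite ler_pM2l.
Qed.

Variables (tau : R) (tau0 : 0 <= tau).

Lemma sectorial_Im M x : sectorial tau M ->
  `|complex.Im (sform M x x)| <= tau * complex.Re (sform M x x).
Proof.
move=> secM; have [->|x0] := eqVneq x 0.
  by rewrite sformr0 /= normr0 mulr0.
by case: (secM x x0).
Qed.

Lemma sectorial_Re_ge0 M x : sectorial tau M -> 0 <= complex.Re (sform M x x).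
Proof.
move=> secM; have [->|x0] := eqVneq x 0; first by rewrite sformr0.
by case: (secM x x0) => /ltW.
Qed.

Lemma sectorial_unit M : sectorial tau M -> M \in unitmx.
Proof.
(* [det0P] yields a row vector in the left kernel; transposing first turns it into a kernel vector
   of [M], whose form would vanish. *)
move=> secM; rewrite -unitmx_tr unitmxE unitfE; apply/det0P => -[v v0 vM].
have : v^T != 0 by apply: contra_neq v0 => /(congr1 trmx); rewrite trmxK trmx0.
move=> /secM [] /[swap] _; rewrite sformE.
have -> : M *m v^T = 0.
  by rewrite -[M]trmxK -trmx_mul vM trmx0.
by rewrite sformr0 ltxx.
Qed.

(* Write M = H + i K with H, K Hermitian, so that |<K z, z>| <= tau <H z, z>.
   Polarization gives 2 Re <K a, b> <= tau (<H a, a> + <H b, b>), used here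
   with a = i (u - x), b = tau x. *)
Lemma sectorial_cauchy_schwarz M x u : sectorial tau M ->
  2 * complex.Re (sform M x u) <=
  complex.Re (sform M u u) + (1 + tau ^+ 2) * complex.Re (sform M x x).
Proof.
move=> secM.
(* The sector condition is used at $iw+rx$ (upper bound on the imaginary part) and $iw-rx$ (lower
   bound). On adding the two, the imaginary parts of the diagonal terms cancel, as do the cross
   terms in the real parts. *)
have polar (r : R) w :
    2 * r * (complex.Re (sform M x w) - complex.Re (sform M w x)) <=
    2 * tau * (complex.Re (sform M w w) + r ^+ 2 * complex.Re (sform M x x)).
  have /ler_normlP[_ h1] := sectorial_Im ('i%C *: w + (r%:C)%C *: x) secM.
  have /ler_normlP[h2 _] := sectorial_Im ('i%C *: w + ((-r)%:C)%C *: x) secM.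
  move: h1 h2; rewrite !sform_lincomb !conjc_real.
  case: (sform M w w) => a a'; case: (sform M w x) => b b'.
  case: (sform M x w) => c c'; case: (sform M x x) => d d' /=.
  move=> h1 h2; lra.
(* Expanding $u=w+x$ reduces the claim to [key]. It is [polar] with [r = tau] divided by [2 * tau];
   for [tau = 0] the choice [r = 1] serves instead. *)
pose w := u - x; have wE : u = w + x by rewrite /w subrK.
clearbody w.
have qx0 := sectorial_Re_ge0 x secM; have qw0 := sectorial_Re_ge0 w secM.
have key : complex.Re (sform M x w) - complex.Re (sform M w x) <=
    complex.Re (sform M w w) + tau ^+ 2 * complex.Re (sform M x x).
  move: (polar 1 w) (polar tau w) qx0 qw0.
  move: (complex.Re (sform M x w)) (complex.Re (sform M w x)) => a b.
  move: (complex.Re (sform M w w)) (complex.Re (sform M x x)) => p q.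
  have [->|tN0] := eqVneq tau 0; first by lra.
  have tp : 0 < 2 * tau by rewrite mulr_gt0 // lt_def tN0.
  by rewrite ler_pM2l.
rewrite wE (sformDl M w) (sformDr M w w) (sformDr M x w x).
rewrite !Re_add; move: key; lra.
Qed.

(** With $u=M^{-1}y$ one has $\langle y,M^{-1}y\rangle=\overline{\langle u,Mu\rangle}$, and the
    sector is symmetric under conjugation. *)
Lemma sectorial_inv M : sectorial tau M -> sectorial tau (invmx M).
Proof.
move=> secM y y0; have uM := sectorial_unit secM.
have yE : y = M *m (invmx M *m y) by rewrite mulKVmx.
have u0 : invmx M *m y != 0.
  by apply: contra_neq y0 => u0; rewrite yE u0 mulmx0.
have -> : sform (invmx M) y y = conjc (sform M (invmx M *m y) (invmx M *m y)).
  by rewrite sformE sform1_conj [in RHS]sformE -yE.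
by rewrite Re_conjc Im_conjc normrN; apply: secM.
Qed.

Lemma Re_sform_wamean M N (s : R) x : complex.Re (sform (wamean s M N) x x) =
  (1 - s) * complex.Re (sform M x x) + s * complex.Re (sform N x x).
Proof.
rewrite /wamean sform_addmx !sform_scalemx Re_add.
by rewrite !Re_realM.
Qed.

Lemma Im_sform_wamean M N (s : R) x : complex.Im (sform (wamean s M N) x x) =
  (1 - s) * complex.Im (sform M x x) + s * complex.Im (sform N x x).
Proof.
rewrite /wamean sform_addmx !sform_scalemx Im_add.
by rewrite !Im_realM.
Qed.

Lemma sectorial_wamean M N (s : R) : 0 <= s <= 1 ->
  sectorial tau M -> sectorial tau N -> sectorial tau (wamean s M N).
Proof.
move=> /andP[s0 s1] secM secN x x0.
have [m1 m2] := secM x x0; have [n1 n2] := secN x x0.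
rewrite Re_sform_wamean Im_sform_wamean; split.
  have [->|sN0] := eqVneq s 0; first lra.
  have sp : 0 < s by rewrite lt_def sN0.
  nra.
move: m2 n2 => /ler_normlP[m2 m3] /ler_normlP[n2 n3]; apply/ler_normlP; split; nra.
Qed.

(** Guarantees that the outer [invmx] in [whmean] is a true inverse; on a singular matrix [invmx]
    returns its argument. *)
Lemma sectorial_whmean_unit M N (s : R) : 0 <= s <= 1 ->
  sectorial tau M -> sectorial tau N ->
  wamean s (invmx M) (invmx N) \in unitmx.
Proof.
move=> s01 secM secN; apply: sectorial_unit.
by apply: sectorial_wamean => //; apply: sectorial_inv.
Qed.

Lemma Re_whmean_le M N (s : R) x : 0 <= s <= 1 ->
  sectorial tau M -> sectorial tau N ->
  complex.Re (sform (whmean s M N) x x) <=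
  (1 + tau ^+ 2) * complex.Re (sform (wamean s M N) x x).
Proof.
move=> s01 secM secN; have uH := sectorial_whmean_unit s01 secM secN.
have uM := sectorial_unit secM; have uN := sectorial_unit secN.
pose y := whmean s M N *m x; have yE : whmean s M N *m x = y by [].
pose u := invmx M *m y; pose v := invmx N *m y.
have xE : x = ((1 - s)%:C)%C *: u + (s%:C)%C *: v.
  by rewrite !scalemxAl -mulmxDl /y mulKVmx.
have Mu : M *m u = y by rewrite mulKVmx.
have Nv : N *m v = y by rewrite mulKVmx.
clearbody y u v.
have := sectorial_cauchy_schwarz x u secM.
have := sectorial_cauchy_schwarz x v secN.
(* The weighted sum of the two Cauchy-Schwarz bounds has $2\Re\langle x,y\rangle$ on the left, and
   this identity puts one $\Re\langle x,y\rangle$ on the right; one copy survives. *)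
have : complex.Re (sform 1%:M x y) =
    (1 - s) * complex.Re (sform M u u) + s * complex.Re (sform N v v).
  rewrite (sformE M) (sformE N) Mu Nv [in LHS]xE sformDl.
  by rewrite (sformZl _ _ u) (sformZl _ _ v) !conjc_real Re_add !Re_realM.
rewrite (sformE M x u) (sformE N x v) Mu Nv Re_sform_wamean.
rewrite (sformE (whmean _ _ _)) yE.
move: (complex.Re (sform 1%:M x y)) (complex.Re (sform M u u)) => a b.
move: (complex.Re (sform N v v)) (complex.Re (sform N x x)) => c d.
move: (complex.Re (sform M x x)) => e xy hN hM.
case/andP: s01 => s0 s1; have := ler_wpM2l s0 hN.
have s1' : 0 <= 1 - s by rewrite subr_ge0.
by have := ler_wpM2l s1' hM; rewrite xy; lra.
Qed.

(* For z = (M !_t N) x the right-hand side is affine in s and equals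
   cos^2 alpha Re <x, z> at s = t. *)
Lemma Re_whmean_ge M N (s c : R) x z : 0 <= s <= 1 ->
  sectorial tau M -> sectorial tau N ->
  (1 + tau ^+ 2) * c = 1 ->
  2 * c * complex.Re (sform 1%:M x z)
    - c * complex.Re (sform (wamean s (invmx M) (invmx N)) z z) <=
  complex.Re (sform (whmean s M N) x x).
Proof.
move=> s01 secM secN c1.
have uH := sectorial_whmean_unit s01 secM secN.
set H := wamean _ _ _ in uH *.
have secH : sectorial tau H.
  by apply: sectorial_wamean => //; apply: sectorial_inv.
pose y := whmean s M N *m x.
have Hy : H *m y = x by rewrite mulKVmx.
(* Scaling [z] by [c] produces $(1+\tau^2)c^2$ in front of $\Re\langle z,Hz\rangle$, which is [c] by
   [c1]. *)
have := sectorial_cauchy_schwarz ((c%:C)%C *: z) y secH.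
rewrite sformE Hy (sformE H y y) Hy (sformE _ x x) -/y.
rewrite sformZl !sformZr !sformZl conjc_real !Re_realM.
rewrite (sform1_conj _ z) (sform1_conj _ y) !Re_conjc.
have e q : (1 + tau ^+ 2) * (c * (c * q)) = c * q by rewrite mulrA c1 mul1r.
rewrite e; lra.
Qed.

End Sectorial.

(** * Integrals over the unit interval and the mean of the measure *)

Section UnitIntervalIntegral.
Variables (R : realType) (nu : probability R R).
Hypothesis nu01 : nu `[0%R, 1%R] = 1%E.
Implicit Types (f : R -> R).

(** A continuous function is bounded on the compact interval, and [nu] is finite there. *)
Lemma continuous_integrable01 f :
  (forall s, 0 <= s <= 1 -> {for s, continuous f}) ->
  nu.-integrable `[0%R, 1%R] (EFin \o f).
Proof.
move=> cf; have cwf : {within `[0%R, 1%R], continuous f}.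
  apply: continuous_in_subspaceT => s; rewrite inE /= in_itv /=; exact: cf.
apply: measurable_bounded_integrable => //.
- by rewrite [X in (X < _)%E]nu01 ltry.
- exact: measurable_realfun.subspace_continuous_measurable_fun.
- have : compact (f @` `[0%R, 1%R]).
    by apply: continuous_compact => //; exact: segment_compact.
  move=> /compact_bounded [M [Mr MP]]; exists M; split => // x Mx y /= y01.
  by apply: MP => //; exists y.
Qed.

Lemma affine_integrable01 (a b : R) :
  nu.-integrable `[0%R, 1%R] (EFin \o (fun s => a + b * s)).
Proof.
apply: continuous_integrable01 => s _.
by apply: continuousD; [exact: cvg_cst|apply: continuousM; [exact: cvg_cst|exact: cvg_id]].
Qed.

Definition mean01 := \int[nu]_(s in `[0%R, 1%R]) s.

Lemma Rintegral_affine01 (a b : R) :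
  \int[nu]_(s in `[0%R, 1%R]) (a + b * s) = a + b * mean01.
Proof.
have mI : measurable (`[0%R, 1%R] : set R) by [].
have ia : nu.-integrable `[0%R, 1%R] (EFin \o (fun _ : R => a)).
  by apply: continuous_integrable01 => s _; exact: cvg_cst.
have ii : nu.-integrable `[0%R, 1%R] (EFin \o (fun s : R => s)).
  by apply: continuous_integrable01 => s _; exact: cvg_id.
have ib : nu.-integrable `[0%R, 1%R] (EFin \o (fun s : R => b * s)).
  apply: continuous_integrable01 => s _.
  by apply: continuousM; [exact: cvg_cst|exact: cvg_id].
by rewrite RintegralD // Rintegral_cst // [X in fine X]nu01 /= mulr1 RintegralZl.
Qed.

(** First-order expansion at 1 with quadratic error. The integrand equals $z/(z(1-s)+s)$ and lies
    between two functions affine in [s], whose integrals involve [nu] only through its mean. *)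
Lemma fnu_bounds (z : R) : 2^-1 <= z ->
  1 + (z - 1) * mean01 - (z - 1) ^+ 2 <= fnu nu z <= 1 + (z - 1) * mean01.
Proof.
move=> z2; have z0 : 0 < z by lra.
have kE s : 0 <= s <= 1 -> 0 < z * (1 - s) + s /\
    ((1 - s) + s / z)^-1 = z / (z * (1 - s) + s).
  move=> /andP[s0 s1]; have d0 : 0 < z * (1 - s) + s by nra.
  split => //; have -> : 1 - s + s / z = (z * (1 - s) + s) / z.
    by field; rewrite gt_eqF.
  by rewrite invf_div.
have ik : nu.-integrable `[0%R, 1%R] (EFin \o (fun s => ((1 - s) + s / z)^-1)).
  apply: continuous_integrable01 => s s01; apply: continuousV.
    have [d0 _] := kE s s01.
    have -> : 1 - s + s / z = (z * (1 - s) + s) / z by field; rewrite gt_eqF.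
    by rewrite mulf_neq0 ?invr_neq0 ?gt_eqF.
  apply: continuousD.
    by apply: continuousB; [exact: cvg_cst|exact: cvg_id].
  by apply: continuousM; [exact: cvg_id|exact: cvg_cst].
apply/andP; split.
- rewrite addrAC -(Rintegral_affine01 (1 - (z - 1) ^+ 2)).
  apply: le_Rintegral => //; first exact: affine_integrable01.
  move=> s /=; rewrite in_itv /= => s01; have [d0 ->] := kE s s01.
  rewrite ler_pdivlMr //; case/andP: s01 => s0 s1.
  rewrite -subr_ge0; set d := z * (1 - s) + s.
  have -> : z - (1 - (z - 1) ^+ 2 + (z - 1) * s) * d =
      (z - 1) ^+ 2 * (d - s * (1 - s)) by rewrite /d; ring.
  (* Here $d\ge s\ge s(1-s)$. *)
  by rewrite mulr_ge0 ?sqr_ge0 // subr_ge0 /d; nra.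
- rewrite -(Rintegral_affine01 1).
  apply: le_Rintegral => //; first exact: affine_integrable01.
  move=> s /=; rewrite in_itv /= => s01; have [d0 ->] := kE s s01.
  rewrite ler_pdivrMr //; case/andP: s01 => s0 s1.
  rewrite -subr_ge0.
  have -> : (1 + (z - 1) * s) * (z * (1 - s) + s) - z = (z - 1) ^+ 2 * (s * (1 - s)) by ring.
  by rewrite mulr_ge0 ?sqr_ge0 // mulr_ge0 // subr_ge0.
Qed.

(** The Carathéodory slope [g] is continuous at 1 with value [t], while [fnu_bounds] forces
    $|\mathrm{mean}-g(z)|\le|z-1|$ for [z] near 1 and distinct from it; limits are unique. *)
Lemma derive_fnu_mean f (t : R) :
  (forall x : R, 0 < x -> f x = fnu nu x) -> is_derive (1 : R) (1 : R) f t ->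
  mean01 = t.
Proof.
move=> fE /is_derive1_caratheodory [g [gE gc g1]].
(* At [z = 1] the two bounds of [fnu_bounds] coincide. *)
have f1 : f 1 = 1.
  rewrite fE //; have := @fnu_bounds 1; rewrite subrr expr0n /= mul0r addr0 subr0.
  by move=> /(_ ltac:(lra)) /le_anti.
have : g z @[z --> (1:R)^'] --> t.
  by rewrite -g1; apply: cvg_within_filter; exact: gc.
have : g z @[z --> (1:R)^'] --> mean01.
  apply/cvgrPdist_le => e e0.
  near=> z.
  have zN1 : z - 1 != 0.
    by rewrite subr_eq0; near: z; exact: nbhs_dnbhs_neq.
  (* The bound by one half keeps [z] in the range of [fnu_bounds]. *)
  have z1 : `|z - 1| <= Num.min e 2^-1.
    rewrite distrC; near: z; apply: cvg_within.
    have m0 : 0 < Num.min e 2^-1 by rewrite lt_min e0 invr_gt0 /=.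
    by have /cvgrPdist_le := @cvg_id _ (nbhs (1:R)); apply.
  move: z1; rewrite le_min => /andP[z1 /ler_normlP[z2 z3]].
  have z4 : 2^-1 <= z by lra.
  have := fnu_bounds z4; rewrite -fE; last lra.
  have -> : f z = 1 + g z * (z - 1) by rewrite -gE f1; ring.
  move=> /andP[h1 h2]; apply: le_trans z1.
  (* Multiplying by $|z-1|>0$ turns the goal into a comparison with the quadratic error
     $(z-1)^2$. *)
  rewrite -(ler_pM2r (x := `|z - 1|)) ?normr_gt0 // -normrM -expr2 real_normK ?num_real //.
  by apply/ler_normlP; split; nra.
by move=> h1 h2; apply: (cvg_unique _ h1 h2).
Unshelve. all: by end_near.
Qed.

End UnitIntervalIntegral.

(** * Continuity of complex-valued functions of a real variable *)

Section ComplexContinuity.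
Variables (R : realType) (s : R).
Implicit Types (F G : R -> R[i]).

(** Componentwise, to match the separate integration of real and imaginary parts in [sigmaf]. *)
Definition ccontinuous F :=
  {for s, continuous (fun r => complex.Re (F r))} /\
  {for s, continuous (fun r => complex.Im (F r))}.

Lemma ccontinuous_cst c : ccontinuous (fun=> c).
Proof. by split; exact: cvg_cst. Qed.

Lemma ccontinuous_real (f : R -> R) :
  {for s, continuous f} -> ccontinuous (fun r => ((f r)%:C)%C).
Proof. by split => //; exact: cvg_cst. Qed.

Lemma ccontinuousD F G :
  ccontinuous F -> ccontinuous G -> ccontinuous (fun r => F r + G r).
Proof.
move=> [F1 F2] [G1 G2]; split.
- have -> : (fun r => complex.Re (F r + G r)) =
    (fun r => complex.Re (F r) + complex.Re (G r)).
    by apply/funext => r; rewrite Re_add.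
  exact: continuousD.
- have -> : (fun r => complex.Im (F r + G r)) =
    (fun r => complex.Im (F r) + complex.Im (G r)).
    by apply/funext => r; rewrite Im_add.
  exact: continuousD.
Qed.

Lemma ccontinuousM F G :
  ccontinuous F -> ccontinuous G -> ccontinuous (fun r => F r * G r).
Proof.
move=> [F1 F2] [G1 G2]; split.
- have -> : (fun r => complex.Re (F r * G r)) =
    (fun r => complex.Re (F r) * complex.Re (G r) -
              complex.Im (F r) * complex.Im (G r)).
    by apply/funext => r; rewrite Re_mul.
  by apply: continuousB; exact: continuousM.
- have -> : (fun r => complex.Im (F r * G r)) =
    (fun r => complex.Re (F r) * complex.Im (G r) +
              complex.Im (F r) * complex.Re (G r)).
    by apply/funext => r; rewrite Im_mul.
  by apply: continuousD; exact: continuousM.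
Qed.

Lemma ccontinuousV F :
  F s != 0 -> ccontinuous F -> ccontinuous (fun r => (F r)^-1).
Proof.
move=> Fs0 [F1 F2].
have nc : {for s, continuous (fun r => (complex.Re (F r) ^+ 2 + complex.Im (F r) ^+ 2)^-1)}.
  apply: continuousV.
    apply: contra_neq Fs0 => /eqP.
    rewrite paddr_eq0 ?sqr_ge0 // !sqrf_eq0 => /andP[/eqP a0 /eqP b0].
    by case: (F s) a0 b0 => a b /= -> ->.
  by apply: continuousD; exact: continuousM.
split.
- have -> : (fun r => complex.Re (F r)^-1) = (fun r =>
    complex.Re (F r) * (complex.Re (F r) ^+ 2 + complex.Im (F r) ^+ 2)^-1).
    by apply/funext => r; case: (F r).
  exact: continuousM.
- have -> : (fun r => complex.Im (F r)^-1) = (fun r =>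
    - (complex.Im (F r) * (complex.Re (F r) ^+ 2 + complex.Im (F r) ^+ 2)^-1)).
    by apply/funext => r; case: (F r).
  by apply: continuousN; exact: continuousM.
Qed.

Lemma ccontinuous_sum (I : Type) (r : seq I) (F : I -> R -> R[i]) :
  (forall i, ccontinuous (F i)) -> ccontinuous (fun u => \sum_(i <- r) F i u).
Proof.
move=> cF; elim: r => [|i r IHr].
  by under eq_fun do rewrite big_nil; exact: ccontinuous_cst.
by under eq_fun do rewrite big_cons; exact: ccontinuousD.
Qed.

Lemma ccontinuous_prod (I : Type) (r : seq I) (F : I -> R -> R[i]) :
  (forall i, ccontinuous (F i)) -> ccontinuous (fun u => \prod_(i <- r) F i u).
Proof.
move=> cF; elim: r => [|i r IHr].
  by under eq_fun do rewrite big_nil; exact: ccontinuous_cst.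
by under eq_fun do rewrite big_cons; exact: ccontinuousM.
Qed.

(** By the Leibniz formula the determinant is a polynomial in the entries. *)
Lemma ccontinuous_det m (H : R -> 'M[R[i]]_m) :
  (forall i j, ccontinuous (fun u => H u i j)) ->
  ccontinuous (fun u => \det (H u)).
Proof.
move=> cH; apply: ccontinuous_sum => p.
apply: ccontinuousM; first exact: ccontinuous_cst.
exact: ccontinuous_prod.
Qed.

Lemma ccontinuous_adj m (H : R -> 'M[R[i]]_m) i j :
  (forall i j, ccontinuous (fun u => H u i j)) ->
  ccontinuous (fun u => (\adj (H u)) i j).
Proof.
move=> cH; under eq_fun do rewrite mxE /cofactor.
apply: ccontinuousM; first exact: ccontinuous_cst.
by apply: ccontinuous_det => k l; under eq_fun do rewrite !mxE; exact: cH.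
Qed.

Lemma ccontinuous_wamean n (M N : 'M[R[i]]_n) i j :
  ccontinuous (fun u => wamean u M N i j).
Proof.
under eq_fun do rewrite !mxE.
apply: ccontinuousD; apply: ccontinuousM; try exact: ccontinuous_cst.
  by apply: ccontinuous_real; apply: continuousB; [exact: cvg_cst|exact: cvg_id].
by apply: ccontinuous_real; exact: cvg_id.
Qed.

End ComplexContinuity.

(** * Entrywise integration of matrix functions and of their forms *)

Section ComplexIntegral.
Variables (R : realType) (nu : probability R R).
Hypothesis nu01 : nu `[0%R, 1%R] = 1%E.
Implicit Types (F G : R -> R[i]).

Definition cintegrable F :=
  nu.-integrable `[0%R, 1%R] (EFin \o (fun s => complex.Re (F s))) /\
  nu.-integrable `[0%R, 1%R] (EFin \o (fun s => complex.Im (F s))).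

Definition cintegral F : R[i] :=
  ((\int[nu]_(s in `[0%R, 1%R]) complex.Re (F s))
     +i* (\int[nu]_(s in `[0%R, 1%R]) complex.Im (F s)))%C.

Let mI : measurable (`[0%R, 1%R] : set R). Proof. by []. Qed.

Let intD (f g : R -> R) :
  nu.-integrable `[0%R, 1%R] (EFin \o f) ->
  nu.-integrable `[0%R, 1%R] (EFin \o g) ->
  nu.-integrable `[0%R, 1%R] (EFin \o (fun s => f s + g s)).
Proof.
by move=> fi gi; have := integrableD mI fi gi; apply: eq_integrable.
Qed.

Let intZ a (f : R -> R) :
  nu.-integrable `[0%R, 1%R] (EFin \o f) ->
  nu.-integrable `[0%R, 1%R] (EFin \o (fun s => a * f s)).
Proof.
by move=> fi; have := integrableZl mI a fi; apply: eq_integrable.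
Qed.

(** Integrability and value are stated together so that finite sums follow by induction. *)
Lemma cintegralD F G : cintegrable F -> cintegrable G ->
  cintegrable (fun s => F s + G s) /\
  cintegral (fun s => F s + G s) = cintegral F + cintegral G.
Proof.
move=> [F1 F2] [G1 G2]; rewrite /cintegrable /cintegral.
have eR : (fun s => complex.Re (F s + G s)) =
    (fun s => complex.Re (F s) + complex.Re (G s)).
  by apply/funext => s; rewrite Re_add.
have eI : (fun s => complex.Im (F s + G s)) =
    (fun s => complex.Im (F s) + complex.Im (G s)).
  by apply/funext => s; rewrite Im_add.
rewrite eR eI; split; first by split; exact: intD.
by rewrite !RintegralD.
Qed.

Lemma cintegralZ c F : cintegrable F ->
  cintegrable (fun s => c * F s) /\
  cintegral (fun s => c * F s) = c * cintegral F.
Proof.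
move=> [F1 F2]; rewrite /cintegrable /cintegral.
have eR : (fun s => complex.Re (c * F s)) =
    (fun s => complex.Re c * complex.Re (F s) + (- complex.Im c) * complex.Im (F s)).
  by apply/funext => s; rewrite Re_mul mulNr.
have eI : (fun s => complex.Im (c * F s)) =
    (fun s => complex.Re c * complex.Im (F s) + complex.Im c * complex.Re (F s)).
  by apply/funext => s; rewrite Im_mul.
rewrite eR eI; split.
  by split; apply: intD; exact: intZ.
rewrite !RintegralD ?RintegralZl //; try exact: intZ.
by case: c {eR eI} => a b /=; congr (_ +i* _)%C; ring.
Qed.

Lemma cintegral_sum (I : Type) (r : seq I) (F : I -> R -> R[i]) :
  (forall i, cintegrable (F i)) ->
  cintegrable (fun s => \sum_(i <- r) F i s) /\
  cintegral (fun s => \sum_(i <- r) F i s) = \sum_(i <- r) cintegral (F i).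
Proof.
move=> iF; elim: r => [|i r [IH1 IH2]].
  (* Writing the empty sum as a zero multiple lets [cintegralZ] give both claims. *)
  have -> : (fun s => \sum_(i <- [::]) F i s) = (fun s => 0 * 0).
    by apply/funext => s; rewrite big_nil mulr0.
  rewrite big_nil; have [|h1 h2] := @cintegralZ 0 (fun=> 0).
    by split; apply: continuous_integrable01 => // s _; exact: cvg_cst.
  by split => //; rewrite h2 mul0r.
have -> : (fun s => \sum_(j <- i :: r) F j s) =
    (fun s => F i s + \sum_(j <- r) F j s).
  by apply/funext => s; rewrite big_cons.
by have [h1 h2] := cintegralD (iF i) IH1; rewrite big_cons h2 IH2.
Qed.

(** For fixed vectors the form is a finite linear combination of matrix entries, so it commutes with
    the integral. *)
Lemma cintegral_sform n (H : R -> 'M[R[i]]_n) x y :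
  (forall i j, cintegrable (fun s => H s i j)) ->
  cintegrable (fun s => sform (H s) x y) /\
  cintegral (fun s => sform (H s) x y) =
  sform (\matrix_(i, j) cintegral (fun s => H s i j)) x y.
Proof.
move=> iH.
have sE M : sform M x y =
    \sum_j \sum_i (y j 0 * (cadj x 0 i)) * M i j.
  rewrite unlock mxE; apply: eq_bigr => j _; rewrite mxE mulr_suml.
  by apply: eq_bigr => i _; ring.
have -> : (fun s => sform (H s) x y) =
    (fun s => \sum_j \sum_i (y j 0 * (cadj x 0 i)) * H s i j).
  by apply/funext => s; rewrite sE.
have i1 j i : cintegrable (fun s => y j 0 * (cadj x 0 i) * H s i j).
  by case: (cintegralZ (y j 0 * (cadj x 0 i)) (iH i j)).
have i2 j : cintegrable (fun s => \sum_i (y j 0 * (cadj x 0 i)) * H s i j).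
  by case: (cintegral_sum (index_enum _) (i1 j)).
have [h1 ->] := cintegral_sum (index_enum _) i2; split => //.
rewrite sE; apply: eq_bigr => j _.
have [_ ->] := cintegral_sum (index_enum _) (i1 j); apply: eq_bigr => i _.
by have [_ ->] := cintegralZ (y j 0 * (cadj x 0 i)) (iH i j); rewrite mxE.
Qed.

Lemma cintegrable_whmean n tau (M N : 'M[R[i]]_n) i j :
  sectorial tau M -> sectorial tau N ->
  cintegrable (fun s => whmean s M N i j).
Proof.
move=> secM secN.
pose H s := wamean s (invmx M) (invmx N).
have uH s : 0 <= s <= 1 -> H s \in unitmx.
  by move=> s01; exact: sectorial_whmean_unit s01 secM secN.
(* Cramer's rule: [G] agrees with the entry of [whmean] on the unit interval, where [H] is
   invertible. It is continuous at every point of the interval, endpoints included, whatever [invmx]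
   does outside. *)
pose G s := (\det (H s))^-1 * (\adj (H s)) i j.
have GE s : s \in (`[0%R, 1%R] : set R) -> G s = whmean s M N i j.
  rewrite inE /= in_itv /= => /uH u.
  by rewrite /whmean -/(wamean s (invmx M) (invmx N)) /invmx u mxE.
have cG s : 0 <= s <= 1 -> ccontinuous s G.
  move=> s01; have cH k l : ccontinuous s (fun u => H u k l).
    exact: ccontinuous_wamean.
  apply: ccontinuousM; last exact: ccontinuous_adj.
  apply: ccontinuousV; last exact: ccontinuous_det.
  by rewrite -unitfE -unitmxE uH.
split.
- have : nu.-integrable `[0%R, 1%R] (EFin \o (fun s => complex.Re (G s))).
    by apply: continuous_integrable01 => // s /cG[].
  by apply: eq_integrable => // s /GE /= ->.
- have : nu.-integrable `[0%R, 1%R] (EFin \o (fun s => complex.Im (G s))).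
    by apply: continuous_integrable01 => // s /cG[].
  by apply: eq_integrable => // s /GE /= ->.
Qed.

End ComplexIntegral.

(** * Integration of the two pointwise bounds *)

Theorem mainTheorem9 (R : realType) (n : nat) (A B : 'M[R[i]]_n)
    (alpha : R) (nu : probability R R) (f : R -> R) (t : R) :
  accretive A -> accretive B ->
  0 <= alpha -> alpha < pi / 2 ->
  numrange A `<=` sector alpha -> numrange B `<=` sector alpha ->
  nu `[0%R, 1%R] = 1%E ->
  (forall x : R, 0 < x -> f x = fnu nu x) ->
  is_derive (1 : R) (1 : R) f t -> 0 < t < 1 ->
  loewner_le ((((cos alpha) ^+ 2)%:C)%C *: ReMx (whmean t A B))
             (ReMx (sigmaf nu A B))
  /\ loewner_le (ReMx (sigmaf nu A B))
                (((((cos alpha) ^+ 2)^-1)%:C)%C *: ReMx (wamean t A B)).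
Proof.
move=> _ _ a0 api WA WB nu01 fE ft /andP[t0 t1].
have secA := sectorial_numrange WA; have secB := sectorial_numrange WB.
have meant : mean01 nu = t := derive_fnu_mean nu01 fE ft.
have cos0 : 0 < cos alpha.
  apply: cos_gt0_pihalf; rewrite api andbT; apply: lt_le_trans a0.
  by rewrite oppr_lt0 divr_gt0 // pi_gt0.
have tan0 : 0 <= tan alpha.
  rewrite /tan divr_ge0 ?(ltW cos0) // sin_ge0_pi // a0 /=.
  by apply: ltW; apply: lt_trans api _; have := pi_gt0 R; lra.
(* $\sec^2\alpha=1+\tan^2\alpha$ identifies the constant of the pointwise bounds. *)
have cE := cos2_tan2 (lt0r_neq0 cos0).
have c1 : (1 + tan alpha ^+ 2) * cos alpha ^+ 2 = 1.
  by rewrite -cE mulVf // expf_neq0 // lt0r_neq0.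
have t01 : 0 <= t <= 1 by rewrite !ltW.
rewrite -!ReMxZ.
have key x := cintegral_sform nu01 x x
  (fun i j => cintegrable_whmean nu01 i j secA secB).
have iE x : complex.Re (sform (sigmaf nu A B) x x) =
    \int[nu]_(s in `[0%R, 1%R]) complex.Re (sform (whmean s A B) x x).
  by have [_] := key x; rewrite -/(sigmaf nu A B) => <-.
have iI x : nu.-integrable `[0%R, 1%R]
    (EFin \o (fun s => complex.Re (sform (whmean s A B) x x))).
  by have [[]] := key x.
have mI : measurable (`[0%R, 1%R] : set R) by [].
split; apply: loewner_leP => x; rewrite !qformE sform_scalemx Re_realM iE.
(* This [z] is built from the weight [t] and stays fixed while [s] varies, so the lower bound is
   affine in [s]. *)
- pose z := whmean t A B *m x.
  have uH := sectorial_whmean_unit t01 secA secB.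
  have Hz : wamean t (invmx A) (invmx B) *m z = x by rewrite mulKVmx.
  pose r := complex.Re (sform 1%:M x z).
  have wz : complex.Re (sform (whmean t A B) x x) = r by rewrite sformE.
  have Hzz : complex.Re (sform (wamean t (invmx A) (invmx B)) z z) = r.
    by rewrite sformE Hz sform1_conj Re_conjc.
  have ge s (s01 : 0 <= s <= 1) := Re_whmean_ge tan0 x z s01 secA secB c1.
  rewrite -/r in ge; clearbody r z.
  rewrite [X in _ * X <= _]wz {wz}; rewrite Re_sform_wamean in Hzz; move: Hzz.
  set c := cos alpha ^+ 2 in c1 ge *.
  set p := complex.Re _; set p' := complex.Re _ => Hzz.
  (* Since $(1-t)p+tp'=r$, the left side is the affine lower bound evaluated at [t]. As [t] is the
     mean of [nu], this value is the integral of that bound. *)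
  have -> : c * r = 2 * c * r - c * p + (c * p - c * p') * t by rewrite -Hzz; ring.
  rewrite -meant -(Rintegral_affine01 nu01).
  apply: le_Rintegral => //; first exact: affine_integrable01.
  move=> s /=; rewrite in_itv /= => s01.
  have := ge s s01; rewrite Re_sform_wamean -/p -/p'; apply: le_trans.
  by rewrite le_eqVlt; apply/orP; left; apply/eqP; ring.
- rewrite cE Re_sform_wamean.
  set k := 1 + _; set p := complex.Re _; set p' := complex.Re _.
  (* The arithmetic mean is itself affine in its weight, so its value at [t] is likewise an integral
     over [s]. *)
  have -> : k * ((1 - t) * p + t * p') = k * p + (k * p' - k * p) * t by ring.
  rewrite -meant -(Rintegral_affine01 nu01).
  apply: le_Rintegral => //; first exact: affine_integrable01.
  move=> s /=; rewrite in_itv /= => s01.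
  have := Re_whmean_le tan0 x s01 secA secB.
  rewrite Re_sform_wamean -/k -/p -/p' => /le_trans; apply.
  by rewrite le_eqVlt; apply/orP; left; apply/eqP; ring.
Qed.
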